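(* Let $(H_w,H_r)$ be a target pair with $b_w=3$ satisfying dominance. Put $H=H_w(3)$, let $\mathcal V$ be the set of positive vertices of $H_w$, and put $\Lambda=\max\{h_3,H_r(b_r)\}$. Suppose there is a rational $\lambda_1$ with $$\max M\ \le\ \lambda_1\ \le\ \min\{h_1,\ H_w(2)-\rho_1,\ H-2\Lambda\},$$ where $M=\{H/3,\rho_1,h_2\}$ if $2\in\mathcal V$ and $M=\{H/3\}$ if $2\notin\mathcal V$. Then the pair is realizable.
   Context: An instance consists of a finite set $E$ of items with rational values $a_i\ge 0$, positive integer sizes $d_i$, and integer capacities $0\le R<D$, with $d_i\le D$ for every item. Write $G(S)=\sum_{i\in S}a_i$ and $d(S)=\sum_{i\in S}d_i$. For $\alpha\in\{w,r\}$ let $U^\alpha(n)$ be the maximum of $G(S)$ over $n$-element sets $S\subseteq E$ with $d(S)\le D$ (for $\alpha=w$) or $d(S)\le R$ (for $\alpha=r$), with value $-\infty$ if there is none; $U^\alpha(0)=0$. The terminal count is $b_\alpha=\min\operatorname{arg\,max}_n U^\alpha(n)$. The hull is the sequence on $\{0,\dots,b_\alpha\}$ obtained by evaluating at integers the upper concave hull of the points $(n,U^\alpha(n))$, $0\le n\le b_\alpha$. A target pair $(H_w,H_r)$ consists of strictly increasing concave rational sequences $H_\alpha$ on $\{0,\dots,b_\alpha\}$ with $H_\alpha(0)=0$ (the zero sequence $(0)$, with $b_\alpha=0$, is allowed). It is realizable if a single instance has terminal counts $b_w,b_r$ and hulls exactly $H_w$ and $H_r$. There is no cardinality cap. Notation.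 $h_n=H_w(n)-H_w(n-1)$, $\rho_m=H_r(m)-H_r(m-1)$, $\rho_1:=0$ if $b_r=0$. A positive count $n\le b_w$ is a vertex of $H_w$ if $n=b_w$ or $h_n\ne h_{n+1}$. Dominance means $H_r(k)\le H_w(\min\{k,b_w\})$ for $0\le k\le b_r$. *)

(* Defs.v *)
From HB Require Import structures.
From mathcomp Require Import all_boot all_order all_algebra.
From mathcomp Require Import constructive_ereal.

Set Implicit Arguments.
Unset Strict Implicit.
Unset Printing Implicit Defensive.

Import Order.TTheory GRing.Theory Num.Theory.

Local Open Scope ring_scope.

Record instance := Instance {
  item : finType;
  value : item -> rat;
  weight : item -> nat;
  capR : nat;
  capD : nat;
  value_ge0 : forall i, 0 <= value i;
  weight_gt0 : forall i, (0 < weight i)%N;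
  capR_lt_capD : (capR < capD)%N;
  weight_le_capD : forall i, (weight i <= capD)%N
}.

Definition gain (I : instance) (S : {set item I}) : rat :=
  \sum_(i in S) value i.

Definition load (I : instance) (S : {set item I}) : nat :=
  (\sum_(i in S) weight i)%N.

(* The convention that the best value with no items is 0 needs no special     *)
(* case: set0 is the only set of cardinal 0, and its load is 0.               *)
Definition best (I : instance) (cap n : nat) : \bar rat :=
  \big[maxe/-oo%E]_(S : {set item I} | (#|S| == n) && (load S <= cap)%N)
    (gain S)%:E.

Definition is_argmax (U : nat -> \bar rat) (n : nat) : Prop :=
  forall m, (U m <= U n)%E.

Definition is_terminal_count (U : nat -> \bar rat) (b : nat) : Prop :=
  is_argmax U b /\ forall n, is_argmax U n -> (b <= n)%N.

(* Finite sequences on {0, ..., b} are encoded as functions on nat of which   *)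
(* only the values at 0, ..., b are ever constrained or used.                 *)

(* Weights of a convex combination of the abscissae 0, ..., b whose           *)
(* barycentre is x.                                                           *)
Definition convex_weights (b : nat) (x : rat) (t : 'I_b.+1 -> rat) : Prop :=
  [/\ forall k, 0 <= t k, \sum_k t k = 1 & \sum_k t k * k%:R = x].

(* The upper concave hull at x is the largest ordinate y such that (x, y) is  *)
(* in the convex hull of the points (k, U k), 0 <= k <= b.  Rational weights  *)
(* are enough, as the points and the abscissa are rational.  A point with     *)
(* U k = -oo does not contribute: 0 * -oo = 0 in \bar rat, and a positive     *)
(* weight on such a point makes the whole sum -oo.                            *)
Definition is_hull (U : nat -> \bar rat) (b : nat) (H : nat -> rat) : Prop :=
  forall n, (n <= b)%N ->
    (exists2 t : 'I_b.+1 -> rat, convex_weights n%:R t &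
       (\sum_(k < b.+1) (t k)%:E * U k)%E = (H n)%:E) /\
    (forall t : 'I_b.+1 -> rat, convex_weights n%:R t ->
       (\sum_(k < b.+1) (t k)%:E * U k <= (H n)%:E)%E).

Definition incr (H : nat -> rat) (n : nat) : rat := H n - H n.-1.

Definition target_seq (b : nat) (H : nat -> rat) : Prop :=
  [/\ H 0%N = 0,
      forall n, (n < b)%N -> H n < H n.+1 &
      forall n, (0 < n < b)%N -> incr H n.+1 <= incr H n].

Definition target_pair (bw br : nat) (Hw Hr : nat -> rat) : Prop :=
  target_seq bw Hw /\ target_seq br Hr.

Definition realizable (bw br : nat) (Hw Hr : nat -> rat) : Prop :=
  exists I : instance,
    [/\ is_terminal_count (best I (capD I)) bw,
        is_terminal_count (best I (capR I)) br,
        is_hull (best I (capD I)) bw Hw &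
        is_hull (best I (capR I)) br Hr].

Definition dominance (bw br : nat) (Hw Hr : nat -> rat) : Prop :=
  forall k, (k <= br)%N -> Hr k <= Hw (minn k bw).

Definition first_incr (b : nat) (H : nat -> rat) : rat :=
  if b == 0%N then 0 else incr H 1.

Definition vertex (b : nat) (H : nat -> rat) (n : nat) : bool :=
  (0 < n <= b)%N && ((n == b) || (incr H n != incr H n.+1)).

(* Main.v *)
Require Import Defs.
From HB Require Import structures.
From mathcomp Require Import all_boot all_order all_algebra.
From mathcomp Require Import constructive_ereal.
From mathcomp Require Import lra zify.

Set Implicit Arguments.
Unset Strict Implicit.
Unset Printing Implicit Defensive.

Import Order.TTheory GRing.Theory Num.Theory.

Local Open Scope ring_scope.

(** Write [h n] for the increments of [Hw], [l] for the given rational and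
    [mu := (Hw 3 - l) / 2].  The bounds on [l] say that [mu <= l] (as
    [Hw 3 / 3 <= l]), that [h 3] and [Hr br] are at most [mu] (as
    [l <= Hw 3 - 2 * Lambda]), hence that [l + mu = (Hw 3 + l) / 2 <= Hw 2],
    and that [h 2 <= l <= h 1] (if 2 is not a vertex, [h 2 = h 3 <= mu]).

    The narrow hull is realized by [br] items of weight 1 and values the
    increments of [Hr], with narrow capacity [br]; all other items are too
    heavy for it.  The wide hull is realized at each count by its own optimal
    set, which fills the wide capacity exactly: one item of value [Hw 1], a
    pair of values [l] and [Hw 2 - l], and a triple of values [l], [mu], [mu],
    where the pair and the triple share the item of value [l].  The weights
    forbid every other combination of these five items except proper subsets of
    the pair and of the triple.  Such a subset leaves room for the narrow
    items, but these are worth at most [mu] together, so the mixture does not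
    rise above [Hw] ([layered_wide]).

    So the best value at count [n] is exactly [Hw n] for [n <= 3] and at most
    [Hw 3] beyond, and similarly for [Hr] ([layered_narrow]).  A strictly
    increasing concave sequence attained in this way is its own hull and ends at
    the terminal count ([terminal_hull_of_target_seq]). *)

(** * Increasing concave sequences *)

Lemma target_seq_mono b H m n :
  target_seq b H -> (m <= n)%N -> (n <= b)%N -> H m <= H n.
Proof.
case=> _ Hlt _; elim: n => [|n IHn]; first by rewrite leqn0 => /eqP ->.
rewrite leq_eqVlt => /predU1P[-> //|le_mn] lt_nb.
exact: le_trans (IHn le_mn (ltnW lt_nb)) (ltW (Hlt n lt_nb)).
Qed.

Lemma target_seq_incr_anti b H i j :
  target_seq b H -> (0 < i)%N -> (i <= j)%N -> (j <= b)%N ->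
  incr H j <= incr H i.
Proof.
case=> _ _ Hcc i_gt0; elim: j => [|j IHj]; first by case: i i_gt0.
rewrite leq_eqVlt => /predU1P[-> //|le_ij] lt_jb.
apply: le_trans (IHj le_ij (ltnW lt_jb)); apply: Hcc.
by rewrite lt_jb andbT (leq_trans i_gt0).
Qed.

(** The slope is the increment into [n]; at [n = 0] there is none, and the
    increment out of [0] serves instead. *)
Lemma target_seq_support b H n :
  target_seq b H -> (n <= b)%N ->
  exists c, forall k, (k <= b)%N -> H k <= H n + c * (k%:R - n%:R).
Proof.
move=> tH le_nb; exists (incr H (maxn n 1)) => k le_kb.
set c := incr H _.
have up d : (n + d <= b)%N -> H (n + d)%N <= H n + c * d%:R.
  elim: d => [|d IHd]; first by rewrite addn0 mulr0 addr0.
  rewrite addnS => lt_b; have := IHd (ltnW lt_b).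
  have : incr H (n + d).+1 <= c.
    by apply: target_seq_incr_anti tH _ _ lt_b; rewrite ?geq_max; lia.
  rewrite /incr /= -natr1; lra.
have down d : (d <= n)%N -> H (n - d)%N <= H n - c * d%:R.
  elim: d => [|d IHd] lt_dn; first by rewrite subn0 mulr0 subr0.
  have := IHd (ltnW lt_dn).
  have : c <= incr H (n - d)%N.
    by apply: target_seq_incr_anti tH _ _ _; rewrite ?geq_max; lia.
  rewrite /incr -subnS -natr1; lra.
case: (leqP n k) => [le_nk | /ltnW le_kn].
  have := up (k - n)%N; rewrite subnKC // => /(_ le_kb).
  by rewrite natrB.
have := down (n - k)%N; rewrite subKn ?leq_subr // => /(_ isT).
by rewrite natrB //; lra.
Qed.

Lemma target_seq_sum_incr b H n :
  target_seq b H -> (n <= b)%N ->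
  \sum_(i < b) incr H i.+1 *+ (i < n)%N = H n.
Proof.
move=> [H0 _ _] le_nb.
rewrite (eq_bigr (fun i : 'I_b => if (i < n)%N then incr H i.+1 else 0));
  last by move=> i _; case: ifP; rewrite ?mulr1n ?mulr0n.
rewrite -big_mkcond /= -(big_ord_widen b (fun i => incr H i.+1) le_nb).
by rewrite -(big_mkord xpredT (fun i => incr H i.+1)) /incr /= telescope_sumr
  // H0 subr0.
Qed.

(** The increments decrease, so any [m] of them sum to at most the first [m]. *)
Lemma target_seq_sum_incr_le b H (P : pred 'I_b) :
  target_seq b H ->
  \sum_(i < b) incr H i.+1 *+ P i <= H (\sum_(i < b) P i)%N.
Proof.
move=> tH.
suff gen n (Q : pred 'I_n) : (n <= b)%N ->
    \sum_(i < n) incr H i.+1 *+ Q i <= H (\sum_(i < n) Q i)%N by exact: gen.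
elim: n Q => [|n IHn] Q lt_nb; first by rewrite !big_ord0; case: tH => ->.
rewrite !big_ord_recr /=.
have := IHn (fun i => Q (widen_ord (leqnSn n) i)) (ltnW lt_nb).
set s := \sum_(i < n) incr _ _ *+ _; set m := (\sum_(i < n) _)%N => le_s.
have le_mn : (m <= n)%N.
  rewrite -[leqRHS]card_ord -sum1_card; apply: leq_sum => i _.
  by case: (Q _).
case: (Q _); last by rewrite mulr0n addr0 addn0.
rewrite mulr1n addn1.
have := target_seq_incr_anti tH (ltn0Sn m) (le_mn : m.+1 <= n.+1)%N lt_nb.
rewrite /incr /= in le_s *; lra.
Qed.

(** * Recognizing terminal counts and hulls *)

Lemma best_le (I : instance) cap n x :
  (forall S : {set item I}, #|S| = n -> (load S <= cap)%N -> gain S <= x) ->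
  (best I cap n <= x%:E)%E.
Proof.
move=> le_x; apply: bigmax_le; first exact: leNye.
by move=> S /andP[/eqP cardS loadS]; rewrite lee_fin le_x.
Qed.

Lemma le_best (I : instance) cap (S : {set item I}) :
  (load S <= cap)%N -> ((gain S)%:E <= best I cap #|S|)%E.
Proof.
by move=> loadS; apply: (bigmax_sup S); rewrite ?eqxx.
Qed.

(** A concave sequence is its own hull, by the support inequality; strict
    monotonicity makes [b] the first count at which the maximum is reached. *)
Lemma terminal_hull_of_target_seq (U : nat -> \bar rat) b H :
  target_seq b H ->
  (forall n, (n <= b)%N -> ((H n)%:E <= U n)%E) ->
  (forall n, (U n <= (H (minn n b))%:E)%E) ->
  is_terminal_count U b /\ is_hull U b H.
Proof.
move=> tH geH leH.
have UE n : (n <= b)%N -> U n = (H n)%:E.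
  move=> le_nb; apply/eqP; rewrite eq_le geH // andbT.
  by have := leH n; rewrite (minn_idPl le_nb).
split.
  split=> [m | n argn].
    rewrite (UE b) //; apply: le_trans (leH m) _.
    by rewrite lee_fin (target_seq_mono tH) // geq_minr.
  rewrite leqNgt; apply/negP => lt_nb.
  have := argn b; rewrite (UE b) // (UE n) ?(ltnW lt_nb) // lee_fin.
  case: (tH) => _ /(_ _ lt_nb) lt_H _.
  have := target_seq_mono tH lt_nb (leqnn b); lra.
have sumE (t : 'I_b.+1 -> rat) :
    (\sum_(k < b.+1) (t k)%:E * U k)%E = (\sum_(k < b.+1) t k * H k)%:E.
  rewrite -sumEFin; apply: eq_bigr => k _.
  by rewrite UE ?EFinM // -ltnS.
move=> n le_nb; split; last first.
  move=> t [t_ge0 t_sum t_bary]; rewrite sumE lee_fin.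
  have [c leHc] := target_seq_support tH le_nb.
  have <- : \sum_(k < b.+1) t k * (H n + c * (k%:R - n%:R)) = H n.
    under eq_bigr => k _ do [rewrite (_ : _ * _ =
      t k * (H n - c * n%:R) + t k * k%:R * c); last by lra].
    by rewrite big_split /= -!mulr_suml t_sum t_bary; lra.
  by apply: ler_sum => k _; rewrite ler_wpM2l // leHc // -ltnS.
have lt_nb : (n < b.+1)%N by [].
have pick (F : nat -> rat) :
    \sum_(k < b.+1) (k == Ordinal lt_nb)%:R * F k = F n.
  rewrite (bigD1 (Ordinal lt_nb)) //= eqxx mul1r big1 ?addr0 // => k.
  by move/negPf => ->; rewrite mul0r.
exists (fun k => (k == Ordinal lt_nb)%:R); last by rewrite sumE pick.
split=> [k||]; first exact: ler0n; last exact: pick.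
by under eq_bigr => k _ do rewrite -[_%:R]mulr1; rewrite (pick (fun=> 1)).
Qed.

(** * The instance *)

(** The index type ['I_5 + 'I_b] separates five heavy items from [b] unit
    items.  The heavy items are, in this order: a singleton optimum, the
    partner that completes the item of value [l] to an optimal pair, and the
    three members of an optimal triple, of values [l], [mu], [mu]. *)
Definition heavy_value (Hw : nat -> rat) (l : rat) : seq rat :=
  let mu := (Hw 3%N - l) / 2 in [:: Hw 1%N; Hw 2%N - l; l; mu; mu].

(** The triple [b + 1, b + 2, b + 2] fills the wide capacity [3 b + 5], the
    partner fills what [b + 1] leaves but not what [b + 2] leaves, and each
    heavy item exceeds the narrow capacity [b]. *)
Definition heavy_weight (b : nat) : seq nat :=
  [:: 3 * b + 5; 2 * b + 4; b + 1; b + 2; b + 2]%N.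

Definition layered_value (Hw Hr : nat -> rat) (l : rat) b
    (i : 'I_5 + 'I_b) : rat :=
  match i with
  | inl j => (heavy_value Hw l)`_j
  | inr k => incr Hr k.+1
  end.

Definition layered_weight b (i : 'I_5 + 'I_b) : nat :=
  match i with
  | inl j => nth 0%N (heavy_weight b) j
  | inr _ => 1%N
  end.

Lemma layered_weight_gt0 b (i : 'I_5 + 'I_b) : (0 < layered_weight i)%N.
Proof. by case: i => // [[[|[|[|[|[|//]]]]] lt5]] /=; lia. Qed.

Lemma layered_weight_le b (i : 'I_5 + 'I_b) : (layered_weight i <= 3 * b + 5)%N.
Proof. by case: i => [[[|[|[|[|[|//]]]]] lt5]|k] /=; lia. Qed.

Lemma layered_cap_lt b : (b < 3 * b + 5)%N.
Proof. by lia. Qed.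

Definition layered_instance (Hw Hr : nat -> rat) (l : rat) b
    (value_ge0 : forall i : 'I_5 + 'I_b, 0 <= layered_value Hw Hr l i) :
    instance :=
  Instance value_ge0 (@layered_weight_gt0 b) (layered_cap_lt b)
    (@layered_weight_le b).

(** The sets that attain the hulls: chosen heavy items and the first [n] unit
    items. *)
Definition layered_set b (s : seq nat) (n : nat) : {set 'I_5 + 'I_b} :=
  [set i : 'I_5 + 'I_b |
    match i with inl j => (j : nat) \in s | inr k => (k < n)%N end].

Definition units b (S : {set 'I_5 + 'I_b}) : nat :=
  (\sum_(k < b) (inr k \in S))%N.

Definition heavy b (S : {set 'I_5 + 'I_b}) (j : nat) : bool :=
  inl (inord j : 'I_5) \in S.

Lemma heavyE b (S : {set 'I_5 + 'I_b}) (j : 'I_5) : (inl j \in S) = heavy S j.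
Proof. by rewrite /heavy inord_val. Qed.

Lemma heavy_layered_set b s n j :
  (j < 5)%N -> heavy (layered_set b s n) j = (j \in s).
Proof. by move=> lt_j5; rewrite /heavy inE inordK. Qed.

Lemma units_layered_set b s n : (n <= b)%N -> units (layered_set b s n) = n.
Proof.
move=> le_nb; rewrite /units.
under eq_bigr => k _ do rewrite inE.
transitivity (\sum_(k < n) 1)%N; last by rewrite sum_nat_const card_ord muln1.
rewrite (big_ord_widen b (fun=> 1%N) le_nb) [RHS]big_mkcond.
by apply: eq_bigr => k _; case: (_ < _)%N.
Qed.

Lemma units_le b (S : {set 'I_5 + 'I_b}) : (units S <= b)%N.
Proof.
rewrite -[leqRHS]card_ord -sum1_card; apply: leq_sum => k _.
by case: (_ \in _).
Qed.

Lemma card_layered b (S : {set 'I_5 + 'I_b}) :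
  #|S| = (heavy S 0 + (heavy S 1 + (heavy S 2 + (heavy S 3 + heavy S 4)))
    + units S)%N.
Proof.
rewrite -sum1_card big_mkcond big_sumType /=.
congr addn; under eq_bigr => j _ do rewrite heavyE.
rewrite !big_ord_recl big_ord0 addn0 /=.
by do 5!case: (heavy _ _).
Qed.

Lemma load_layered (Hw Hr : nat -> rat) (l : rat) b v (S : {set 'I_5 + 'I_b}) :
  load (S : {set item (@layered_instance Hw Hr l b v)}) =
  (heavy S 0 * (3 * b + 5) + (heavy S 1 * (2 * b + 4) + (heavy S 2 * (b + 1)
    + (heavy S 3 * (b + 2) + heavy S 4 * (b + 2)))) + units S)%N.
Proof.
rewrite /load big_mkcond big_sumType /=.
congr addn; under eq_bigr => j _ do rewrite heavyE.
rewrite !big_ord_recl big_ord0 addn0 /=.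
by do 5!case: (heavy _ _); rewrite ?mul1n.
Qed.

Definition unit_gain Hr b (S : {set 'I_5 + 'I_b}) : rat :=
  \sum_(k < b) incr Hr k.+1 *+ (inr k \in S).

Lemma gain_layered (Hw Hr : nat -> rat) (l : rat) b v (S : {set 'I_5 + 'I_b}) :
  let mu := (Hw 3%N - l) / 2 in
  gain (S : {set item (@layered_instance Hw Hr l b v)}) =
  Hw 1%N *+ heavy S 0 + ((Hw 2%N - l) *+ heavy S 1 + (l *+ heavy S 2
    + (mu *+ heavy S 3 + mu *+ heavy S 4))) + unit_gain Hr S.
Proof.
rewrite /gain big_mkcond big_sumType /=.
congr +%R; last by apply: eq_bigr => k _; case: (_ \in _).
under eq_bigr => j _ do rewrite heavyE.
rewrite !big_ord_recl big_ord0 addr0 /=.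
by do 5!case: (heavy _ _).
Qed.

Lemma unit_gain_le b Hr (S : {set 'I_5 + 'I_b}) :
  target_seq b Hr -> unit_gain Hr S <= Hr (units S).
Proof. exact: target_seq_sum_incr_le. Qed.

Lemma unit_gain_layered_set b Hr s n :
  target_seq b Hr -> (n <= b)%N -> unit_gain Hr (layered_set b s n) = Hr n.
Proof.
move=> tHr le_nb; rewrite -(target_seq_sum_incr tHr le_nb).
by apply: eq_bigr => k _; rewrite inE.
Qed.

(** * The two hulls of the instance *)

Lemma layered_narrow (Hw Hr : nat -> rat) (l : rat) b v :
  target_seq b Hr ->
  is_terminal_count (best (@layered_instance Hw Hr l b v) b) b /\
  is_hull (best (@layered_instance Hw Hr l b v) b) b Hr.
Proof.
move=> tHr; apply: terminal_hull_of_target_seq => // n.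
  move=> le_nb;
  have := @le_best (@layered_instance Hw Hr l b v) b (layered_set b [::] n).
  rewrite load_layered card_layered gain_layered unit_gain_layered_set //
    units_layered_set //.
  by rewrite !heavy_layered_set //= !mulr0n !add0r; apply.
apply: best_le => S; rewrite card_layered load_layered gain_layered.
have := unit_gain_le S tHr; have := units_le S.
move: (unit_gain _ _) (units _) => g u le_ub le_g.
do 5![case: (heavy _ _); first by lia].
by rewrite /= !mulr0n !add0r => <- _; rewrite (minn_idPl _).
Qed.

(** A feasible set has as heavy part the singleton optimum alone, the partner
    with or without the item of value [l], or a subset of the triple.  The
    singleton optimum, the pair and the full triple leave no room for unit
    items.  In the other cases the unit items are together worth at most
    [mu <= l], so adding any number of them gains no more than adding one heavy
    item: the partner stays below [Hw 2], one member of the triple below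
    [l + mu <= Hw 2], and two members below [Hw 3].  The empty heavy part is
    what dominance is for. *)
Lemma layered_wide (Hw Hr : nat -> rat) (l : rat) b v :
  let mu := (Hw 3%N - l) / 2 in
  target_seq 3 Hw -> target_seq b Hr -> dominance 3 b Hw Hr ->
  [/\ l <= Hw 1%N, Hw 2%N - Hw 1%N <= l, mu <= l, l + mu <= Hw 2%N
    & Hr b <= mu] ->
  is_terminal_count (best (@layered_instance Hw Hr l b v) (3 * b + 5)) 3 /\
  is_hull (best (@layered_instance Hw Hr l b v) (3 * b + 5)) 3 Hw.
Proof.
move=> mu tHw tHr dom [le_l1 le_l2 le_mul le_lmu le_Hrmu].
have muE : mu = (Hw 3%N - l) / 2 by [].
have [Hw0 Hwlt _] := tHw; have [Hr0 _ _] := tHr.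
have lt01 := Hwlt 0%N isT; have lt12 := Hwlt 1%N isT; have lt23 := Hwlt 2%N isT.
clear Hwlt.
apply: terminal_hull_of_target_seq => // n.
  move=> le_n3.
  pose s := nth [::] [:: [::]; [:: 0]; [:: 1; 2]; [:: 2; 3; 4]]%N n.
  have := @le_best (@layered_instance Hw Hr l b v) (3 * b + 5)
    (layered_set b s 0).
  rewrite load_layered card_layered gain_layered unit_gain_layered_set //
    units_layered_set //.
  rewrite !heavy_layered_set // Hr0 -/mu {}/s.
  case: n le_n3 => [|[|[|[|//]]]] _ /=; rewrite ?(mulr1n, mulr0n, mul0n, mul1n).
  - by rewrite !addr0 Hw0; apply; lia.
  - by rewrite !addr0; apply; lia.
  - by rewrite !(addr0, add0r) subrK; apply; lia.
  - rewrite !(addr0, add0r) (_ : l + (mu + mu) = Hw 3%N); last by lra.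
    by apply; lia.
apply: best_le => S; rewrite card_layered load_layered gain_layered -/mu.
have := unit_gain_le S tHr; have := units_le S.
move: (unit_gain _ _) (units _) => g u le_ub le_gu <-.
have le_gb : g <= mu.
  by apply: le_trans le_gu (le_trans _ le_Hrmu); apply: target_seq_mono tHr _ _.
have le_empty : g <= Hw (minn u 3) by exact: le_trans le_gu (dom u le_ub).
have [u0 | u_gt0] := posnP u.
  have g_le0 : g <= 0 by rewrite -Hr0 -u0.
  rewrite {}u0 in le_empty *.
  do 5!case: (heavy _ _); rewrite /= ?(mulr1n, mulr0n, mul0n, mul1n) => load_le;
    try by [exfalso; move: load_le; clear; lia | lra].
have le_count c : Hw (minn c.+1 3) <= Hw (minn (c + u) 3).
  by apply: target_seq_mono tHw _ _; lia.
(* A set with [c >= 1] heavy items and some unit item has at least [c + 1]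
   items, so it is enough to bound its gain by [Hw (c + 1)]. *)
have le_count1 : Hw 2%N <= Hw (minn (1 + u) 3) := le_count 1%N.
have le_count2 : Hw 3%N <= Hw (minn (2 + u) 3) := le_count 2%N.
clear le_count.
do 5!case: (heavy _ _); rewrite /= ?(mulr1n, mulr0n, mul0n, mul1n) => load_le;
  try by exfalso; move: load_le u_gt0; clear; lia.
all: by rewrite ?add0n ?addn0 ?addn1; lra.
Qed.

Theorem theoremA1 (br : nat) (Hw Hr : nat -> rat) :
  target_pair 3 br Hw Hr ->
  dominance 3 br Hw Hr ->
  let h := incr Hw in
  let rho1 := first_incr br Hr in
  let H := Hw 3%N in
  let Lambda := Num.max (h 3%N) (Hr br) in
  let maxM :=
    if vertex 3 Hw 2 then Num.max (H / 3) (Num.max rho1 (h 2%N)) else H / 3 in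
  (exists lambda1 : rat,
     maxM <= lambda1 <=
       Num.min (h 1%N) (Num.min (Hw 2%N - rho1) (H - 2 * Lambda))) ->
  realizable 3 br Hw Hr.
Proof.
move=> [tHw tHr] dom h rho1 H Lambda maxM [l].
rewrite !le_min => /andP[le_Ml /and3P[le_lh1 _ le_lL]].
have [Hw0 Hwlt _] := tHw; have [Hr0 Hrlt _] := tHr.
have lt01 := Hwlt 0%N isT; have lt12 := Hwlt 1%N isT; have lt23 := Hwlt 2%N isT.
have [leh3L leHrL] : h 3%N <= Lambda /\ Hr br <= Lambda.
  by rewrite !le_max !lexx orbT.
have leHl : H / 3 <= l.
  by apply: le_trans le_Ml; rewrite /maxM; case: ifP; rewrite ?le_max lexx.
have leh2l : h 2%N <= l.
  move: le_Ml; rewrite /maxM; case: ifP => [_|].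
    by rewrite !ge_max => /and3P[].
  (* As 2 is not a vertex, [h 2 = h 3 <= Lambda], and the two bounds on [l]
     give [Lambda <= H / 3 <= l]. *)
  rewrite /vertex /= => /negbFE/eqP; rewrite /h /H in leh3L le_lL leHl *.
  by move=> -> _; lra.
rewrite /h /incr /= in le_lh1 leh2l leh3L; rewrite /H in leHl le_lL.
have v (i : 'I_5 + 'I_br) : 0 <= layered_value Hw Hr l i.
  case: i => [[[|[|[|[|[|//]]]]] lt5] /=|k]; try by lra.
  by rewrite /= /incr /= subr_ge0 ltW // Hrlt.
have [] := @layered_wide Hw Hr l br v tHw tHr dom; first by split; lra.
have [] := @layered_narrow Hw Hr l br v tHr.
by exists (layered_instance v).
Qed.
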